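(* Let $\phi:(0,\infty)\to(0,\infty)$ be a strictly convex function but $\phi\notin\Phi$. For measures $P\in\mathcal{D}$ (with density function $p$), one has $$\widetilde{\Omega}_\phi^{orlicz}(P)\le\mu(p)\,\phi\left(\frac{\mu(p^\circ)}{\mu(\gamma_n)}\right)\le\phi(c_1^n)\,c_1^{-n}\,\mu(\gamma_n),$$ where $c_1>0$ is the constant determined by $c_1=\left(\frac{\mu(p^\circ)}{\mu(\gamma_n)}\right)^{1/n}$. These inequalities also hold for the dual functional Orlicz geominimal surface area $\widetilde{G}_\phi^{orlicz}(P)$ (in place of $\widetilde{\Omega}_\phi^{orlicz}(P)$) if in addition $P\in\mathcal{D}$ is a log-concave measure, i.e. its density function $p$ is a log-concave function.
   Context: The underlying space is $\mathbb{R}^n$ with $\mu$ the Lebesgue measure; for a function $p$ write $\mu(p)=\int_{\mathbb{R}^n}p(x)\,dx$. $\mathcal{F}^+$ is the set of positive real-valued measurable functions on $\mathbb{R}^n$, and $\mathcal{M}^+$ is the set of finite measures on $\mathbb{R}^n$ whose density functions with respect to Lebesgue measure are in $\mathcal{F}^+$. Let $\gamma_n(x)=e^{-\|x\|_2^2/2}$ with $\|\cdot\|_2$ the Euclidean norm. For $p\in\mathcal{F}^+$, its polar dual function is $p^\circ(y)=\inf_{x\in\mathbb{R}^n}\frac{e^{-\langle x,y\rangle}}{p(x)}$. Let $\mathcal{D}=\{p\in\mathcal{F}^+:\mu(p)\mu(p^\circ)\le[\mu(\gamma_n)]^2\}$, and let $\mathcal{L}_c$ be the set of all log-concave functions (functions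 of the form $e^{-\psi}$ with $\psi$ convex). Saying that a measure $Q$ is in $\mathcal{D}$ (or in $\mathcal{D}\cap\mathcal{L}_c$) means that its density function $q$ is in $\mathcal{D}$ (respectively in $\mathcal{D}\cap\mathcal{L}_c$). $\Phi$ is the set of functions $\phi:(0,\infty)\to(0,\infty)$ that are decreasing and strictly convex; thus a strictly convex $\phi\notin\Phi$ is one that is not decreasing. For measures $P,Q$ with densities $p,q$, $D_\phi(Q,P)=\int_{\mathbb{R}^n}\phi\left(\frac{q(x)}{p(x)}\right)p(x)\,dx$. For such $\phi$ and $P\in\mathcal{M}^+$, the dual functional Orlicz affine surface area of $P$ is $$\widetilde{\Omega}_\phi^{orlicz}(P)=\inf_{Q\in\mathcal{D}}D_\phi\left(\frac{\mu(q^\circ)}{\mu(\gamma_n)}Q,P\right),$$ where $q$ is the density function of $Q$, and the dual functional Orlicz geominimal surface area $\widetilde{G}_\phi^{orlicz}(P)$ is defined in the same way with $\mathcal{D}$ replaced by $\mathcal{D}\cap\mathcal{L}_c$. *)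

(* Defs.v *)
From HB Require Import structures.
From mathcomp Require Import all_boot all_order all_algebra.
From mathcomp Require Import all_classical all_reals all_analysis.

Set Implicit Arguments.
Unset Strict Implicit.
Unset Printing Implicit Defensive.
Import Order.TTheory GRing.Theory Num.Theory.
Import numFieldNormedType.Exports.

Local Open Scope classical_set_scope.
Local Open Scope ring_scope.

(* The space R^n is 'rV[R]_n, which has neither a sigma-algebra nor a Lebesgue
   measure in MathComp-Analysis. *)

(* The sigma-algebra generated by the coordinate maps, i.e. the Borel sets. *)
Section measurable_rV.
Context {R : realType} (n : nat).

Let coord : 'I_n -> 'rV[R]_n -> measurableTypeR R := fun i v => v 0 i.

Let rV_set0 : g_sigma_preimage coord set0.
Proof. exact: sigma_algebra0. Qed.

Let rV_setC A : g_sigma_preimage coord A -> g_sigma_preimage coord (~` A).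
Proof. exact: sigma_algebraC. Qed.

Let rV_bigcup (F : (set 'rV[R]_n)^nat) :
  (forall i, g_sigma_preimage coord (F i)) ->
  g_sigma_preimage coord (\bigcup_i (F i)).
Proof. exact: sigma_algebra_bigcup. Qed.

HB.instance Definition _ := @isMeasurable.Build default_measure_display
  'rV[R]_n (g_sigma_preimage coord) rV_set0 rV_setC rV_bigcup.

End measurable_rV.

Lemma measurable_coord (R : realType) (n : nat) (i : 'I_n) :
  measurable_fun [set: 'rV[R]_n] (fun v => v 0 i : measurableTypeR R).
Proof.
move=> _ Y mY; rewrite setTI; apply: sub_sigma_algebra => /=.
rewrite -bigcup_seq/=; exists i => /=; first by rewrite mem_index_enum.
by exists Y => //; rewrite setTI.
Qed.

Lemma measurable_fun_coordP d (T : measurableType d) (R : realType) (n : nat)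
    (f : T -> 'rV[R]_n) :
  (forall i, measurable_fun setT (fun x => f x 0 i : measurableTypeR R)) ->
  measurable_fun setT f.
Proof.
move=> mf _ A mA; rewrite setTI.
suff : g_sigma_preimage (fun i (v : 'rV[R]_n) => v 0 i : measurableTypeR R) `<=`
    [set B | measurable (f @^-1` B)] by move=> /(_ A mA).
apply: smallest_sub.
  split => /=.
  - by rewrite preimage_set0; exact: measurable0.
  - by move=> B mB; rewrite setTD preimage_setC; exact: measurableC.
  - by move=> F mF; rewrite preimage_bigcup; exact: bigcup_measurable.
rewrite -bigcup_seq/= => B [i _ [C mC <-]] /=.
have := mf i measurableT C mC.
by rewrite !setTI.
Qed.

Section lebesgue_rV_step.
Context {R : realType} (n : nat) (m : {sigma_finite_measure set 'rV[R]_n -> \bar R}).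

Definition cons_rV (xv : measurableTypeR R * 'rV[R]_n) : 'rV[R]_n.+1 :=
  \row_i oapp (xv.2 0) xv.1 (unlift ord0 i).

Definition uncons_rV (v : 'rV[R]_n.+1) : measurableTypeR R * 'rV[R]_n :=
  (v 0 ord0, \row_j v 0 (lift ord0 j)).

Lemma cons_rVK : cancel cons_rV uncons_rV.
Proof.
move=> [x v]; rewrite /uncons_rV /cons_rV mxE unlift_none/=; congr pair.
by apply/rowP => j; rewrite !mxE liftK.
Qed.

Lemma uncons_rVK : cancel uncons_rV cons_rV.
Proof.
by move=> v; apply/rowP => i; rewrite !mxE; case: unliftP => [j ->|->] /=;
  rewrite ?mxE.
Qed.

Lemma measurable_cons_rV : measurable_fun setT cons_rV.
Proof.
apply: measurable_fun_coordP => i.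
under eq_fun do rewrite mxE.
case: (unlift ord0 i) => [j|] /=; last exact: measurable_fst.
exact: (measurableT_comp (measurable_coord (R := R) j) measurable_snd).
Qed.

Lemma measurable_uncons_rV : measurable_fun setT uncons_rV.
Proof.
apply/measurable_fun_pairP; split; first exact: measurable_coord.
apply: measurable_fun_coordP => i.
rewrite /comp /=; under eq_fun do rewrite mxE.
exact: measurable_coord.
Qed.

Definition lebesgue_rVS : set 'rV[R]_n.+1 -> \bar R :=
  pushforward (lebesgue_measure \x m)%E cons_rV.

Let preim A : measurable A -> measurable (cons_rV @^-1` A).
Proof. by move=> mA; rewrite -[X in measurable X]setTI; exact: measurable_cons_rV. Qed.

Let lebesgue_rVS0 : lebesgue_rVS set0 = 0%E.
Proof. by rewrite /lebesgue_rVS /pushforward preimage_set0 measure0. Qed.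

Let lebesgue_rVS_ge0 A : (0 <= lebesgue_rVS A)%E.
Proof. by rewrite /lebesgue_rVS /pushforward measure_ge0. Qed.

Let lebesgue_rVS_semi_sigma_additive : semi_sigma_additive lebesgue_rVS.
Proof.
move=> F mF tF mUF; rewrite /lebesgue_rVS /pushforward preimage_bigcup.
apply: measure_semi_sigma_additive.
- by move=> k; exact: preim.
- apply/trivIsetP => /= i j _ _ ij; rewrite -preimage_setI.
  by move/trivIsetP : tF => /(_ _ _ _ _ ij) ->//; rewrite preimage_set0.
- by rewrite -preimage_bigcup; exact: preim.
Qed.

HB.instance Definition _ := isMeasure.Build _ _ _ lebesgue_rVS
  lebesgue_rVS0 lebesgue_rVS_ge0 lebesgue_rVS_semi_sigma_additive.

Let lebesgue_rVS_sigma_finite : sigma_finite setT lebesgue_rVS.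
Proof.
have /sigma_finiteP[F [TF ndF Foo]] :=
  sigma_finiteT (@lebesgue_measure R : {sigma_finite_measure set _ -> \bar R}).
have /sigma_finiteP[G [TG ndG Goo]] := sigma_finiteT m.
exists (fun k => uncons_rV @^-1` (F k `*` G k)).
  rewrite -preimage_bigcup; apply/esym; rewrite -subTset => v _ /=.
  have [i _ Fi] : (\bigcup_i F i) (uncons_rV v).1 by rewrite -TF.
  have [j _ Gj] : (\bigcup_i G i) (uncons_rV v).2 by rewrite -TG.
  exists (maxn i j) => //; split => /=.
  - by move: Fi; exact/subsetPset/ndF/leq_maxl.
  - by move: Gj; exact/subsetPset/ndG/leq_maxr.
move=> k; have [mF Fkoo] := Foo k; have [mG Gkoo] := Goo k; split.
  rewrite -[X in measurable X]setTI; apply: measurable_uncons_rV => //.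
  exact: measurableX.
rewrite /lebesgue_rVS /pushforward -comp_preimage.
rewrite (_ : _ \o _ = id); last by apply/funext => x /=; rewrite cons_rVK.
by rewrite preimage_id product_measure1E// lte_mul_pinfty// ge0_fin_numE.
Qed.

HB.instance Definition _ := Measure_isSigmaFinite.Build _ _ _ lebesgue_rVS
  lebesgue_rVS_sigma_finite.

End lebesgue_rV_step.

(* R^(n+1) is identified with R * R^n through cons_rV, and the measure is the
   corresponding product; lebesgue_rV_box gives its value on boxes. *)
Fixpoint lebesgue_rV (R : realType) (n : nat) :
    {sigma_finite_measure set 'rV[R]_n -> \bar R} :=
  match n with
  | 0 => \d_ (0 : 'rV[R]_0)
  | k.+1 => lebesgue_rVS (lebesgue_rV R k)
  end.

Lemma lebesgue_rV_box (R : realType) (n : nat) (A : 'I_n -> set (measurableTypeR R)) :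
  (forall i, measurable (A i)) ->
  lebesgue_rV R n [set v | forall i, A i (v 0 i)] =
  (\prod_(i < n) lebesgue_measure (A i))%E.
Proof.
elim: n A => [|n IH] A mA.
  rewrite big_ord0 /= /dirac indicE mem_set//=.
  by case.
rewrite big_ord_recl -(IH (A \o lift ord0)); last by move=> i; exact: mA.
rewrite /= /lebesgue_rVS /pushforward.
rewrite -product_measure1E//; last first.
  rewrite [X in measurable X](_ : _ = \bigcap_(i in setT)
      ((fun v : 'rV[R]_n => v 0 i : measurableTypeR R) @^-1` A (lift ord0 i))).
    apply: fin_bigcap_measurable; first exact: finite_finset.
    by move=> i _; rewrite -[X in measurable X]setTI; exact: measurable_coord.
  by apply/seteqP; split=> v /= h i; [move=> _; exact: h | exact: h].
congr (_ _); apply/seteqP; split=> -[x v] /= h.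
  split; first by have := h ord0; rewrite mxE unlift_none.
  by move=> i; have := h (lift ord0 i); rewrite mxE liftK.
by move=> i; rewrite mxE; case: unliftP => [j ->|->] /=; [exact: h.2 | exact: h.1].
Qed.

Section functions.
Context {R : realType} {n : nat}.
Implicit Types (p q : 'rV[R]_n -> R) (x y : 'rV[R]_n).

Definition dotp x y : R := \sum_(i < n) x 0 i * y 0 i.

Definition enorm x : R := Num.sqrt (dotp x x).

Definition mass p : \bar R := (\int[lebesgue_rV R n]_x (p x)%:E)%E.

Definition gaussian x : R := expR (- (enorm x ^+ 2 / 2)).

(* For p in Fplus the infimum is over a nonempty set of positive reals, so the
   real-valued inf is the genuine infimum (possibly 0). *)
Definition polar p y : R := inf (range (fun x => expR (- dotp x y) / p x)).

Definition Fplus p : Prop :=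
  measurable_fun setT (p : _ -> measurableTypeR R) /\ forall x, 0 < p x.

Definition in_D p : Prop :=
  Fplus p /\ (mass p * mass (polar p) <= mass gaussian ^+ 2)%E.

(* psi may be taken real-valued because only positive p are considered. *)
Definition log_concave p : Prop :=
  exists2 psi : 'rV[R]_n -> R,
    convex_function (E := 'rV[R]_n) setT psi & forall x, p x = expR (- psi x).

End functions.

(* D_phi depends on the measures only through their densities q and p. *)
Definition orlicz_divergence (R : realType) (n : nat) (phi : R -> R)
    (q p : 'rV[R]_n -> R) : \bar R :=
  (\int[lebesgue_rV R n]_x (phi (q x / p x) * p x)%:E)%E.

(* A density is determined only almost everywhere by its measure, whereas polar
   depends on its pointwise values; the chosen density is part of the data. *)
Record Mplus (R : realType) (n : nat) := MkMplus {
  Mplus_measure :> {finite_measure set 'rV[R]_n -> \bar R} ;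
  density : 'rV[R]_n -> R ;
  density_Fplus : Fplus density ;
  densityE : forall A : set 'rV[R]_n, measurable A ->
    Mplus_measure A = (\int[lebesgue_rV R n]_(x in A) (density x)%:E)%E
}.

Section orlicz.
Context {R : realType} {n : nat}.
Implicit Types (phi : R -> R) (P Q : Mplus R n).

(* Functions (0, oo) -> (0, oo) are functions R -> R of which only the values
   on positive arguments are constrained and used. *)
Definition positive_on_pos phi : Prop := forall s, 0 < s -> 0 < phi s.

Definition decreasing_on_pos phi : Prop :=
  forall s t, 0 < s -> s < t -> phi t < phi s.

Definition strictly_convex_on_pos phi : Prop :=
  forall s t a, 0 < s -> 0 < t -> s != t -> 0 < a -> a < 1 ->
    phi (a * s + (1 - a) * t) < a * phi s + (1 - a) * phi t.

Definition Phi phi : Prop :=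
  [/\ positive_on_pos phi, decreasing_on_pos phi & strictly_convex_on_pos phi].

(* The density of mu(q°) / mu(gamma_n) Q. Since q > 0, the condition defining D
   makes mu(q°) finite whenever q is in D. *)
Definition normalized_density Q (x : 'rV[R]_n) : R :=
  fine (mass (polar (density Q)) / mass (gaussian (n := n)))%E * density Q x.

(* phi is defined on (0, oo) only, so D_phi(mu(q°) / mu(gamma_n) Q, P) is
   defined exactly for the Q with mu(q°) > 0. *)
Definition admissible Q : Prop := (0 < mass (polar (density Q)))%E.

Definition dual_orlicz_affine phi P : \bar R :=
  ereal_inf [set orlicz_divergence phi (normalized_density Q) (density P) | Q in
    [set Q | in_D (density Q) /\ admissible Q]].

Definition dual_orlicz_geominimal phi P : \bar R :=
  ereal_inf [set orlicz_divergence phi (normalized_density Q) (density P) | Q in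
    [set Q | [/\ in_D (density Q), log_concave (density Q) & admissible Q]]].

End orlicz.

(* Main.v *)
Require Import Defs.
From mathcomp Require Import all_boot all_order all_algebra.
From mathcomp Require Import all_classical all_reals all_analysis.
Import Order.TTheory GRing.Theory Num.Theory.
Local Open Scope ring_scope.
Local Open Scope ereal_scope.

(** Since [P] itself belongs to the class over which the infimum is taken, the
    first inequality is the comparison with the competitor [Q = P]: the density
    of the normalised [Q] is then [c * p] with [c = mu(p°) / mu(gamma_n)], the
    integrand [phi (c * p / p) * p] is [phi c * p], and the divergence is
    exactly [mu(p) * phi c].  The same competitor is log-concave as soon as [p]
    is, which gives the geominimal case.

    The second inequality is the condition [mu(p) mu(p°) <= mu(gamma_n)^2]
    defining D: divided by [mu(p°)] it reads [mu(p) <= mu(gamma_n) / c], and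
    [c = c1 ^ n].

    No value of the Gaussian integral has to be computed.  The n-th root of
    [mu(p°) / mu(gamma_n)] is the positive real [c1], and the conventions
    [0^-1 = +oo], [+oo^-1 = 0] and [0 * +oo = 0] make that quotient [0] or
    [+oo] as soon as one of the two masses is [0] or [+oo]; hence both masses
    are positive reals.  Positivity of [mu(p°)] is also what admits [P] as a
    competitor. *)

Lemma polar_ge0 (R : realType) (n : nat) (p : 'rV[R]_n -> R)
    (p_ge0 : forall x, (0 <= p x)%R) (y : 'rV[R]_n) : (0 <= polar p y)%R.
Proof.
apply: lb_le_inf; first by exists (expR (- dotp 0%R y) / p 0%R)%R; exists 0%R.
by move=> _ [x _ <-]; rewrite divr_ge0 ?expR_ge0.
Qed.

Lemma mass_ge0 (R : realType) (n : nat) (p : 'rV[R]_n -> R)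
    (p_ge0 : forall x, (0 <= p x)%R) : 0 <= mass p.
Proof. by apply: integral_ge0 => x _; rewrite lee_fin. Qed.

(** The limit values of [/] and [`^] rule out every degenerate quotient, so a
    finite nonzero root forces a genuine quotient of positive reals. *)
Lemma poweR_inv_div_fin (R : realType) (n : nat) (n_gt0 : (0 < n)%N)
    (a g : \bar R) (a_ge0 : 0 <= a) (g_ge0 : 0 <= g)
    (c : R) (c_gt0 : (0 < c)%R) (cE : c%:E = (a / g) `^ (n%:R^-1)%R) :
  exists a' g' : R, [/\ (0 < a')%R, (0 < g')%R, a = a'%:E, g = g'%:E &
    (c ^+ n = a' / g')%R].
Proof.
have nV_neq0 : (n%:R^-1 : R)%R != 0%R by rewrite invr_eq0 pnatr_eq0 -lt0n.
have quot_neq0 : a / g != 0.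
  apply/eqP => ag0; move: cE; rewrite ag0 poweR0r// => -[c0].
  by rewrite c0 ltxx in c_gt0.
have quot_neqy : a / g != +oo.
  by apply/eqP => agoo; move: cE; rewrite agoo poweRyr.
have a_gt0 : 0 < a.
  rewrite lt0e a_ge0 andbT; apply: contra_neq quot_neq0 => ->.
  by rewrite mul0e.
have g_neqy : g != +oo.
  by apply: contra_neq quot_neq0 => ->; rewrite invey mule0.
have g_gt0 : 0 < g.
  rewrite lt0e g_ge0 andbT; apply: contra_neq quot_neqy => ->.
  by rewrite inve0 gt0_muley.
case: g => [g||] // in g_ge0 g_gt0 g_neqy quot_neq0 quot_neqy cE *.
rewrite lte_fin in g_gt0.
rewrite inver (gt_eqF g_gt0) in quot_neqy cE.
have a_neqy : a != +oo.
  apply: contra_neq quot_neqy => ->.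
  by rewrite gt0_mulye// lte_fin invr_gt0.
case: a => [a||] // in a_ge0 a_gt0 a_neqy quot_neq0 quot_neqy cE *.
rewrite lte_fin in a_gt0.
exists a, g; split=> //.
move: cE; rewrite -EFinM poweR_EFin => -[->].
rewrite -powR_mulrn ?powR_ge0// -powRrM mulVf ?powRr1//; last by rewrite pnatr_eq0 -lt0n.
by rewrite divr_ge0 ?ltW.
Qed.

(** The divergence of a constant multiple: the ratio of densities is constant,
    so [phi] leaves the integral. *)
Lemma orlicz_divergence_scale (R : realType) (n : nat) (phi : R -> R)
    (p : 'rV[R]_n -> R) (pF : Fplus p) (c : R) (phic_ge0 : (0 <= phi c)%R) :
  orlicz_divergence phi (fun x => c * p x)%R p = mass p * (phi c)%:E.
Proof.
have [mp p_gt0] := pF.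
rewrite /orlicz_divergence muleC /mass -ge0_integralZl//.
- by apply: eq_integral => x _; rewrite mulfK ?gt_eqF.
- exact/measurable_realfun.measurable_EFinP.
- by move=> x _; rewrite lee_fin ltW.
Qed.

Theorem theorem17 (R : realType) (n : nat) (hn : (0 < n)%N) (phi : R -> R)
    (phi_pos : positive_on_pos phi) (phi_convex : strictly_convex_on_pos phi)
    (phi_notin_Phi : ~ Phi phi) (P : Mplus R n) (PD : in_D (density P))
    (c1 : R) (c1_gt0 : (0 < c1)%R)
    (c1E : c1%:E = (mass (polar (density P)) / mass (@gaussian R n))
                     `^ (n%:R^-1)%R) :
  let middle := mass (density P) *
    (phi (fine (mass (polar (density P)) / mass (@gaussian R n))))%:E in
  let right := (phi (c1 ^+ n)%R)%:E * (c1 ^- n)%R%:E * mass (@gaussian R n) in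
  (dual_orlicz_affine phi P <= middle /\ middle <= right) /\
  (log_concave (density P) ->
    dual_orlicz_geominimal phi P <= middle /\ middle <= right).
Proof.
move=> middle right.
have [pF p_le] := PD.
have p_ge0 x : (0 <= density P x)%R by rewrite ltW//; exact: pF.2.
have [a [g [a_gt0 g_gt0 aE gE c1nE]]] := poweR_inv_div_fin _ _ hn _ _
  (mass_ge0 _ _ _ (polar_ge0 _ _ _ p_ge0))
  (mass_ge0 _ _ _ (fun x => expR_ge0 _)) _ c1_gt0 c1E.
have quotE : fine (mass (polar (density P)) / mass (@gaussian R n)) = (c1 ^+ n)%R.
  by rewrite aE [X in _ / X]gE inver gt_eqF//= c1nE.
have phic_gt0 : (0 < phi (c1 ^+ n))%R by rewrite phi_pos ?exprn_gt0.
have divE : orlicz_divergence phi (normalized_density P) (density P) = middle.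
  by rewrite /middle /normalized_density orlicz_divergence_scale// quotE ltW.
have admP : admissible P by rewrite /admissible aE lte_fin.
have mid_right : middle <= right.
  rewrite /middle /right quotE muleC -muleA lee_pmul2l ?lte_fin//.
  rewrite gE c1nE invf_div -EFinM.
  rewrite aE [X in _ <= X ^+ 2]gE -EFin_expe -lee_pdivlMr// in p_le.
  by apply: le_trans p_le _; rewrite lee_fin expr2 mulrAC.
split; last move=> p_lc.
- by split=> //; apply: ereal_inf_lbound; exists P.
- by split=> //; apply: ereal_inf_lbound; exists P.
Qed.
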